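(* Let $k,m>0$ be integers with $\gcd(k,m)=1$, and let $q=2^k$. Let $\alpha\in\mathbb{F}_{2^m}$ be such that the polynomial $x^{q+1}+x+\alpha$ has no root in $\mathbb{F}_{2^m}$. Let $F:\mathbb{F}_{2^m}\times\mathbb{F}_{2^m}\to\mathbb{F}_{2^m}\times\mathbb{F}_{2^m}$ be given by $$F(x,y)=\left(x^{q+1}+xy^q+\alpha y^{q+1},\; x^{q^2+1}+\alpha x^{q^2}y+(1+\alpha)^q xy^{q^2}+\alpha y^{q^2+1}\right).$$ Then $F$ is APN.
   Context: $\mathbb{F}_{2^m}$ denotes the finite field with $2^m$ elements. A function $F:V\to V$, where $V=\mathbb{F}_{2^m}\times\mathbb{F}_{2^m}$ (identified with $\mathbb{F}_{2^{2m}}$ as an additive group), is called almost perfect nonlinear (APN) if $\max_{a\in V\setminus\{0\},\,b\in V}|\{z\in V : F(z+a)+F(z)=b\}|=2$. *)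

(* Defs.v *)
From HB Require Import structures.
From mathcomp Require Import all_boot all_order all_algebra all_field.

Set Implicit Arguments.
Unset Strict Implicit.
Unset Printing Implicit Defensive.

Import GRing.Theory.
Local Open Scope ring_scope.

HB.instance Definition _ (U W : finZmodType) := Finite.on (U * W)%type.

(* The derivative in direction a is written F (z + a) + F z, as is usual for
   groups of exponent 2, the only ones for which the notion is intended. *)
Definition APN (V : finZmodType) (F : V -> V) : Prop :=
  (\max_(a : V | a != 0%R) \max_(b : V)
     #|[set z : V | (F (z + a) + F z)%R == b]| = 2)%N.

Definition biproj_fun (L : finFieldType) (k : nat) (alpha : L)
    (z : L * L) : L * L :=
  let q := (2 ^ k)%N in
  let x := z.1 in
  let y := z.2 in
  ( x ^+ (q + 1) + x * y ^+ q + alpha * y ^+ (q + 1),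
    x ^+ (q ^ 2 + 1) + alpha * x ^+ (q ^ 2) * y
      + (1 + alpha) ^+ q * x * y ^+ (q ^ 2) + alpha * y ^+ (q ^ 2 + 1) ).

(* Main.v *)
(** Let [s] be the coordinatewise [q]-power map on [L * L], let [[u, v]] be the
    2x2 determinant and let [N = twist alpha], so that [det N = alpha]. The two
    components of [F] are [f z = [s z, N z]] and
    [g z = - [s^2 z, s(N) N z]]. If [d] and [a <> 0] are such that the polar
    forms of [f] and [g] vanish at [(d, a)], the Pluecker relation gives
    [f d * (f a)^q = (f d)^q * f a]. Since [f] has no nontrivial zero,
    [f d / f a] is fixed by the [q]-power map, hence lies in the prime field:
    either [f d = 0], or [f d = f a] and then [f (d + a) = 0]. So [d] is [0]
    or [a]. *)
Require Import Defs.
From mathcomp Require Import all_boot all_order all_algebra all_field.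
From mathcomp Require Import ring.

Import GRing.Theory.
Local Open Scope ring_scope.

Definition det2 {R : comNzRingType} (u v : R * R) : R :=
  u.1 * v.2 - u.2 * v.1.

Definition twist {R : comNzRingType} (c : R) (z : R * R) : R * R :=
  (- (z.1 + c * z.2), z.1).

Definition pair_pow {R : comNzRingType} (q : nat) (z : R * R) : R * R :=
  (z.1 ^+ q, z.2 ^+ q).

Lemma det2_twist (R : comNzRingType) (c : R) (u v : R * R) :
  det2 (twist c u) (twist c v) = c * det2 u v.
Proof. by rewrite /det2 /=; ring. Qed.

Lemma det2_pluecker (R : comNzRingType) (a b c d : R * R) :
  det2 a b * det2 c d = det2 a c * det2 b d - det2 a d * det2 b c.
Proof. by rewrite /det2; ring. Qed.

(** The hypotheses make the 3x3 matrix with entries [det2 zi wj] symmetric. By [det2_pluecker] the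
    two sides are its minors on rows 1, 0 and columns 2, 1, and on rows 2, 1 and columns 1, 0. *)
Lemma det2_polar_proportional (R : comNzRingType) (z0 z1 z2 w0 w1 w2 : R * R) :
  det2 z1 w0 = det2 z0 w1 -> det2 z2 w0 = det2 z0 w2 ->
  det2 z2 w1 = det2 z1 w2 ->
  det2 z1 z0 * det2 w2 w1 = det2 z2 z1 * det2 w1 w0.
Proof.
move=> e10 e20 e21.
by rewrite !(det2_pluecker _ z1 z0, det2_pluecker _ z2 z1) e10 e20 e21; ring.
Qed.

(** Bezout gives [i * k = j * m + 1], so raising [t] to the power [2 ^ (i * k)] yields both [t] and
    [t ^+ 2]. *)
Lemma fixed_pow2_coprime (R : pzSemiRingType) (k m : nat) (t : R) :
  (0 < k)%N -> coprime k m ->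
  t ^+ (2 ^ k) = t -> t ^+ (2 ^ m) = t -> t ^+ 2 = t.
Proof.
move=> k_gt0 /eqP co_km tk tm.
have iter_fix n j : t ^+ (2 ^ n) = t -> t ^+ (2 ^ (j * n)) = t.
  move=> tn; elim: j => [|j IHj]; first by rewrite mul0n expr1.
  by rewrite mulSn expnD exprM tn.
case: (egcdnP m k_gt0) => i j def_ik _.
rewrite -{2}(iter_fix k i tk) def_ik co_km expnD expn1 exprM.
by rewrite (iter_fix m j tm).
Qed.

Section CharTwo.

Variables (L : finFieldType) (k m : nat).
Hypothesis cardL : #|L| = (2 ^ m)%N.
Let q := (2 ^ k)%N.

Lemma pchar2 : 2%N \in [pchar L].
Proof. exact: card_finPcharP cardL isT. Qed.

Lemma oppr_pair (v : L * L) : - v = v.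
Proof. by case: v => x y; congr (_, _); rewrite (oppr_pchar2 pchar2). Qed.

Lemma powD (x y : L) : (x + y) ^+ q = x ^+ q + y ^+ q.
Proof. by apply: exprDn_pchar; rewrite /q pnatX pnatE // pchar2. Qed.

Lemma powN (x : L) : (- x) ^+ q = - x ^+ q.
Proof. by rewrite !(oppr_pchar2 pchar2). Qed.

Lemma pair_pow_twist (c : L) z :
  pair_pow q (twist c z) = twist (c ^+ q) (pair_pow q z).
Proof. by rewrite /pair_pow /twist /= powN powD exprMn. Qed.

Lemma det2_pair_pow (u v : L * L) :
  det2 (pair_pow q u) (pair_pow q v) = det2 u v ^+ q.
Proof. by rewrite /det2 powD powN !exprMn. Qed.

Variable alpha : L.
Let N1 := twist alpha.
Let N2 := twist (alpha ^+ q) \o N1.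

Lemma biproj_funE z :
  biproj_fun k alpha z
    = (det2 (pair_pow q z) (N1 z), - det2 (pair_pow q (pair_pow q z)) (N2 z)).
Proof.
rewrite /biproj_fun -/q /det2 /N2 /N1 /= powD expr1n.
(* The determinant produces the coefficient [1 - alpha ^+ q]; the sign is adjusted so that [ring]
   can conclude. *)
rewrite -[in 1 + _](oppr_pchar2 pchar2 (alpha ^+ q)).
by rewrite -mulnn !exprD !exprM !expr1; congr (_, _); ring.
Qed.

(** Both components are sums of products of two additive maps of [z], so the second difference does
    not depend on the base point. *)
Lemma biproj_fun_polar (z d a : L * L) :
  biproj_fun k alpha (z + d + a) - biproj_fun k alpha (z + d)
    - (biproj_fun k alpha (z + a) - biproj_fun k alpha z)
  = (det2 (pair_pow q d) (N1 a) + det2 (pair_pow q a) (N1 d),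
     - (det2 (pair_pow q (pair_pow q d)) (N2 a)
        + det2 (pair_pow q (pair_pow q a)) (N2 d))).
Proof.
case: z d a => [z1 z2] [d1 d2] [a1 a2].
rewrite !biproj_funE /det2 /N2 /N1 /= !powD.
by congr (_, _) => /=; ring.
Qed.

Hypotheses (k_gt0 : (0 < k)%N) (co_km : coprime k m).
Hypothesis no_root : forall x : L, x ^+ (q + 1) + x + alpha != 0.

Lemma alpha_neq0 : alpha != 0.
Proof. by have := no_root 0; rewrite addn1 expr0n !add0r. Qed.

(** Dehomogenization: for [y != 0], dividing by [y ^+ (q + 1)] would make [x / y] a root of the
    polynomial; for [y = 0] only [x ^+ (q + 1)] is left. *)
Lemma biproj_fun1_eq0 z : (biproj_fun k alpha z).1 = 0 -> z = 0.
Proof.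
case: z => x y; rewrite /biproj_fun -/q /=.
have [->|y_neq0] := eqVneq y 0.
  rewrite addn1 !expr0n /q expn_eq0 /= !mulr0 !addr0.
  by move/eqP; rewrite expf_eq0 /= => /eqP->.
move=> f0; have /eqP[] := no_root (x / y).
apply: (mulIf (expf_neq0 (q + 1) y_neq0)); rewrite mul0r -[RHS]f0.
rewrite !mulrDl expr_div_n divfK ?expf_neq0 //; congr (_ + _ + _).
by rewrite addn1 exprS mulrA divfK.
Qed.

Lemma polar_kernel (d a : L * L) : a != 0 ->
  det2 (pair_pow q d) (N1 a) + det2 (pair_pow q a) (N1 d) = 0 ->
  det2 (pair_pow q (pair_pow q d)) (N2 a)
    + det2 (pair_pow q (pair_pow q a)) (N2 d) = 0 ->
  d = 0 \/ d = a.
Proof.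
move=> a_neq0 f_da g_da.
pose f z := (biproj_fun k alpha z).1.
have fE z : f z = det2 (pair_pow q z) (N1 z) by rewrite /f biproj_funE.
have det2C (u v : L * L) : det2 u v = - det2 v u by rewrite /det2; ring.
have fa_neq0 : f a != 0 by apply: contraNneq a_neq0 => /biproj_fun1_eq0->.
have f_da' : det2 (pair_pow q d) (N1 a) = det2 (N1 d) (pair_pow q a).
  by rewrite (det2C (N1 d)); apply/eqP; rewrite -addr_eq0 f_da.
have f_prop : f d * f a ^+ q = f d ^+ q * f a.
  (* Scaling everything by [s(N) N] puts the three iterates [N2 d],
     [s(N) (s d)] and [s^2 d] on the same footing, at the cost of a factor
     [alpha ^+ q]. *)
  have := @det2_polar_proportional _
    (N2 d) (twist (alpha ^+ q) (pair_pow q d)) (pair_pow q (pair_pow q d))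
    (N2 a) (twist (alpha ^+ q) (pair_pow q a)) (pair_pow q (pair_pow q a)).
  rewrite /N2 /= !det2_twist -/N1 -!pair_pow_twist -/N1 !det2_pair_pow -!fE.
  move=> prop; apply: (mulfI (expf_neq0 q alpha_neq0)).
  (* The three symmetry conditions are [f_da'] times [alpha ^+ q], [g_da], and the [q]-th power of
     [f_da']. *)
  rewrite mulrA prop ?f_da' //; first by ring.
  by rewrite (det2C (twist _ _) (pair_pow _ _)); apply/eqP; rewrite -addr_eq0 g_da.
have : (f d / f a) ^+ 2 = f d / f a.
  apply: (@fixed_pow2_coprime _ k m) => //; last by rewrite -cardL expf_card.
  rewrite -/q expr_div_n; apply/eqP.
  by rewrite eqr_div ?expf_neq0 // -f_prop.
move/eqP; rewrite -subr_eq0 expr2 -[X in _ - X]mulr1 -mulrBr mulf_eq0.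
rewrite mulf_eq0 invr_eq0 (negPf fa_neq0) orbF subr_eq0.
case/orP=> [/eqP/biproj_fun1_eq0 -> | fd_fa]; [by left | right].
move/eqP/divr1_eq in fd_fa.
have fda0 : f (d + a) = 0.
  (* At base point 0, the vanishing of the polar form reads [f (d + a) = f d + f a], which is twice
     [f a]. *)
  have : f (0 + d + a) - f (0 + d) - (f (0 + a) - f 0) = 0.
    by rewrite -[RHS]f_da; exact: (congr1 fst (biproj_fun_polar 0 d a)).
  have -> : f 0 = 0 by rewrite fE /det2 /=; ring.
  by rewrite !add0r fd_fa subr0 -addrA -opprD (addrr_pchar2 pchar2) subr0.
by apply/eqP; rewrite -[a]oppr_pair -addr_eq0; apply/eqP/biproj_fun1_eq0.
Qed.

(** The second difference at [z0] along [z - z0] and [a] compares the two derivatives, so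
    [polar_kernel] applies to [z - z0]. *)
Lemma biproj_fun_fiber (z0 z a : L * L) : a != 0 ->
  biproj_fun k alpha (z + a) + biproj_fun k alpha z
    = biproj_fun k alpha (z0 + a) + biproj_fun k alpha z0 ->
  z = z0 \/ z = z0 + a.
Proof.
move=> a_neq0 eq_F.
have := biproj_fun_polar z0 (z - z0) a; set d := z - z0.
have -> : z0 + d = z by rewrite addrC subrK.
rewrite !oppr_pair eq_F -[X in _ + X]oppr_pair subrr => -[] /esym f0 /esym/eqP.
rewrite oppr_eq0 => /eqP g0.
case: (polar_kernel _ _ a_neq0 f0 g0) => [/eqP | <-].
  by rewrite subr_eq0 => /eqP; left.
by right; rewrite addrC subrK.
Qed.

End CharTwo.

Theorem theorem3 (k m : nat) (L : finFieldType) (alpha : L)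
    (hk : (0 < k)%N) (hm : (0 < m)%N) (hkm : coprime k m)
    (hL : #|L| = (2 ^ m)%N)
    (halpha : forall x : L,
       ~~ root ('X^(2 ^ k + 1) + 'X + alpha%:P : {poly L}) x) :
  APN (biproj_fun k alpha).
Proof.
have no_root (x : L) : x ^+ (2 ^ k + 1) + x + alpha != 0.
  by have := halpha x; rewrite /root !hornerE.
rewrite /APN; apply/eqP; rewrite eqn_leq; apply/andP; split.
  apply/bigmax_leqP => a a_neq0; apply/bigmax_leqP => b _.
  have [-> | [z0]] := set_0Vmem [set z | biproj_fun k alpha (z + a)
                                           + biproj_fun k alpha z == b].
    by rewrite cards0.
  rewrite inE => /eqP z0_b; apply: (@leq_trans #|[set z0; z0 + a]|).
    apply: subset_leq_card; apply/subsetP => z; rewrite !inE -z0_b => /eqP.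
    by move/(biproj_fun_fiber _ _ _ hL _ hk hkm no_root _ _ _ a_neq0) => [->|->];
      rewrite eqxx ?orbT.
  by rewrite cards2; case: (_ != _).
pose a : L * L := (1, 0).
have a_neq0 : a != 0 by rewrite -pair_eqE /= oner_eq0.
apply: (bigmax_sup a) => //.
(* Since [a + a = 0], the derivative in direction [a] takes this value at both 0 and [a]. *)
apply: (bigmax_sup (biproj_fun k alpha a + biproj_fun k alpha 0)) => //.
apply: (@leq_trans #|[set 0; a]|); first by rewrite cards2 eq_sym a_neq0.
apply: subset_leq_card; apply/subsetP => z; rewrite !inE.
case/orP=> /eqP->; first by rewrite add0r.
by rewrite -[X in a + X](oppr_pair _ _ hL) subrr addrC.
Qed.
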